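(* Let $L$ be a pseudocomplemented De Morgan algebra. If $L$ is subdirectly irreducible, then either $|Body(L)|<2$, or $Body(L)=\{P,\phi(P)\}$ for some $P$ with $\phi(P)\neq P$.
   Context: A pseudocomplemented De Morgan algebra ($pm$-algebra) is an algebra $\langle L,\wedge,\vee,{}',{}^*,0,1\rangle$ such that $\langle L,\wedge,\vee,0,1\rangle$ is a bounded distributive lattice, ${}'$ is a De Morgan negation ($x''=x$, $(x\wedge y)'=x'\vee y'$), and ${}^*$ is a pseudocomplement ($a\wedge b=0\Leftrightarrow b\le a^*$). Congruences and subdirect irreducibility are with respect to this full signature. $\mathbb{X}(L)$ denotes the set of prime filters of $L$ ordered by inclusion, and $\phi:\mathbb{X}(L)\to\mathbb{X}(L)$ is the order-reversing involution $\phi(P)=L\setminus\{a':a\in P\}$. $Max$ and $Min$ denote the sets of maximal and minimal elements of $\mathbb{X}(L)$, and $Body(L)=\mathbb{X}(L)\setminus(Max\cup Min)$. *)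

(* Defs.v *)
From HB Require Import structures.
From mathcomp Require Import all_boot all_order.
From mathcomp Require Import boolp classical_sets functions cardinality.

Set Implicit Arguments.
Unset Strict Implicit.
Unset Printing Implicit Defensive.

Import Order.TTheory.
Local Open Scope classical_set_scope.

(* The one-element algebra is allowed: tbDistrLatticeType does not require
   \bot != \top. *)
HB.mixin Record isPseudocomplementedDeMorgan (d : Order.disp_t) L
    of Order.TBDistrLattice d L := {
  neg : L -> L;
  pcompl : L -> L;
  negK : forall x : L, neg (neg x) = x;
  negI : forall x y : L, neg (x `&` y)%O = (neg x `|` neg y)%O;
  pcomplP : forall a b : L, (a `&` b)%O = \bot%O <-> (b <= pcompl a)%O;
}.

#[short(type="pmAlgebraType")]
HB.structure Definition PMAlgebra (d : Order.disp_t) :=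
  {L of Order.TBDistrLattice d L & isPseudocomplementedDeMorgan d L}.

Record pm_morphism (d : Order.disp_t) (L : pmAlgebraType d)
    (e : Order.disp_t) (M : pmAlgebraType e) (f : L -> M) : Prop := PMMorphism {
  pm_morphI : {morph f : x y / (x `&` y)%O >-> (x `&` y)%O};
  pm_morphU : {morph f : x y / (x `|` y)%O >-> (x `|` y)%O};
  pm_morph_neg : {morph f : x / neg x >-> neg x};
  pm_morph_pcompl : {morph f : x / pcompl x >-> pcompl x};
  pm_morph0 : f \bot%O = \bot%O;
  pm_morph1 : f \top%O = \top%O;
}.

(* An embedding of L into the product of the A i is given by its coordinates
   f i; it is a homomorphism iff each f i is one, and it is injective iff the
   f i jointly separate the elements of L. *)
Record subdirect_embedding (d : Order.disp_t) (L : pmAlgebraType d)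
    (I : Type) (e : I -> Order.disp_t) (A : forall i, pmAlgebraType (e i))
    (f : forall i, L -> A i) : Prop := SubdirectEmbedding {
  subdirect_morphism : forall i, pm_morphism (f i);
  subdirect_inj : forall x y : L, (forall i, f i x = f i y) -> x = y;
  subdirect_surj : forall (i : I) (b : A i), exists a : L, f i a = b;
}.

(* Every subdirect embedding has a coordinate that is an isomorphism.  Index
   types are nonempty, so the one-element algebra counts as irreducible. *)
Definition subdirectly_irreducible (d : Order.disp_t) (L : pmAlgebraType d) :
    Prop :=
  forall (I : Type) (e : I -> Order.disp_t) (A : forall i, pmAlgebraType (e i))
    (f : forall i, L -> A i),
    inhabited I -> subdirect_embedding f ->
    exists i, pm_morphism (f i) /\ bijective (f i).

Record prime_filter (d : Order.disp_t) (L : pmAlgebraType d) (P : set L) :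
    Prop := PrimeFilter {
  prime_filter1 : P \top%O;
  prime_filter0 : ~ P \bot%O;
  prime_filterI : forall a b : L, P a -> P b -> P (a `&` b)%O;
  prime_filterS : forall a b : L, (a <= b)%O -> P a -> P b;
  prime_filterU : forall a b : L, P (a `|` b)%O -> P a \/ P b;
}.

Section Spectrum.
Variables (d : Order.disp_t) (L : pmAlgebraType d).

Definition XX : set (set L) := [set P | prime_filter P].

Definition phi (P : set L) : set L := ~` [set neg a | a in P].

Definition MaxX : set (set L) :=
  [set P | XX P /\ forall Q, XX Q -> P `<=` Q -> Q = P].

Definition MinX : set (set L) :=
  [set P | XX P /\ forall Q, XX Q -> Q `<=` P -> Q = P].

Definition Body : set (set L) := XX `\` (MaxX `|` MinX).

Lemma phiE (P : set L) a : phi P a <-> ~ P (neg a).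
Proof.
split=> [nPa Pa|nPa [b Pb ba]]; first by apply: nPa; exists (neg a); rewrite ?negK.
by apply: nPa; rewrite -ba negK.
Qed.

Lemma negU (x y : L) : neg (x `|` y)%O = (neg x `&` neg y)%O.
Proof. by rewrite -[RHS]negK negI !negK. Qed.

Lemma neg0 : neg (\bot%O : L) = \top%O.
Proof. by apply/eqP; rewrite -le1x leEjoin -{1}[\top%O]negK -negI meetx0. Qed.

Lemma neg1 : neg (\top%O : L) = \bot%O.
Proof. by rewrite -neg0 negK. Qed.

Lemma le_neg (a b : L) : (a <= b)%O -> (neg b <= neg a)%O.
Proof. by move=> /meet_idPl ab; rewrite leEjoin -negI meetC ab. Qed.

Lemma phi_prime_filter (P : set L) : XX P -> XX (phi P).
Proof.
case=> P1 P0 PI PS PU; split.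
- by apply/phiE; rewrite neg1.
- by move/phiE; rewrite neg0.
- by move=> a b /phiE Pa /phiE Pb; apply/phiE; rewrite negI => /PU[].
- by move=> a b ab /phiE Pa; apply/phiE => Pb; apply: Pa; exact: PS (le_neg ab) Pb.
- move=> a b /phiE; rewrite negU => nP.
  have [Pa|Pa] := pselect (P (neg a)); last by left; apply/phiE.
  by right; apply/phiE => Pb; apply: nP; exact: PI.
Qed.

Lemma phiK (P : set L) : phi (phi P) = P.
Proof.
apply/seteqP; split=> a; last by move=> Pa; apply/phiE => /phiE; rewrite negK.
by move/phiE => nPa; apply: contrapT => Pa; apply: nPa; apply/phiE; rewrite negK.
Qed.

Lemma phi_subset (P Q : set L) : P `<=` Q -> phi Q `<=` phi P.
Proof. by move=> PQ a /phiE Qa; apply/phiE => /PQ. Qed.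

End Spectrum.

Arguments XX {d} L.
Arguments MaxX {d} L.
Arguments MinX {d} L.
Arguments Body {d} L.

(* Main.v *)
Require Import Defs.
From HB Require Import structures.
From mathcomp Require Import all_boot all_order.
From mathcomp Require Import boolp classical_sets functions cardinality.
Local Open Scope classical_set_scope.
Local Open Scope card_scope.

(** The proof is Priestley duality made concrete.  A set [Y] of prime filters
that is stable under [phi] and contains every maximal prime filter defines a
congruence, [x ~ y] iff the members of [Y] that contain [x] are those that
contain [y]: stability under [phi] takes care of [neg], and the maximal filters
take care of [pcompl], because [pcompl a] lies in a prime filter [P] iff [a]
lies in no maximal filter above [P] ([prime_filter_pcompl]).

Since [phi] exchanges maximal and minimal prime filters, the set
[Max u Min u {P, phi P}] is of this kind for every [P] in the body.  Prime
filters separate points, so the quotients of [L] by these congruences, [P]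
running over the body, form a subdirect embedding.  If [L] is subdirectly
irreducible, one of the congruences is therefore the equality.

On the other hand these sets are closed in the patch topology of the spectrum:
a non-maximal prime filter misses some dense element [a v pcompl a], which all
maximal filters contain, so [Max] is closed ([separated_MaxX]); so is [Min], its
image under [phi]; and points are closed.  A prime filter outside of
[Max u Min u {P, phi P}] thus has a basic neighbourhood that avoids this set,
and such a neighbourhood yields two distinct congruent elements.  Hence, for the
[P] whose congruence is the equality, [P] and [phi P] exhaust the body. *)

Set Implicit Arguments.
Unset Strict Implicit.
Unset Printing Implicit Defensive.

Import Order.TTheory.
Local Open Scope order_scope.

(** * Prime filters *)

Section PrimeFilters.
Variables (d : Order.disp_t) (L : pmAlgebraType d).
Implicit Types (P Q R M F : set L) (S T : set (set L)) (a b x y : L).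

Record filter F : Prop := Filter {
  filter1 : F \top;
  filterI : forall a b, F a -> F b -> F (a `&` b);
  filterS : forall a b, a <= b -> F a -> F b;
}.

Lemma prime_filter_filter P : XX L P -> filter P.
Proof. by case. Qed.

Definition adjoin F a : set L := [set y | exists2 q, F q & q `&` a <= y].

Lemma adjoin_filter F a : filter F -> filter (adjoin F a).
Proof.
case=> F1 FI FS; split.
- by exists \top => //; exact: lex1.
- move=> x y [p Fp px] [q Fq qy]; exists (p `&` q); first exact: FI.
  rewrite lexI; apply/andP; split.
    by apply: le_trans px; rewrite leI2// leIl.
  by apply: le_trans qy; rewrite leI2// leIr.
- by move=> x y xy [q Fq qx]; exists q => //; exact: le_trans xy.
Qed.

Lemma sub_adjoin F a : F `<=` adjoin F a.
Proof. by move=> x Fx; exists x => //; exact: leIl. Qed.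

Lemma adjoin_mem F a : filter F -> adjoin F a a.
Proof. by case=> F1 _ _; exists \top => //; exact: leIr. Qed.

Lemma maximal_avoiding_filter F b : filter F -> ~ F b ->
  exists M, [/\ filter M, F `<=` M, ~ M b &
    forall N, filter N -> M `<=` N -> ~ N b -> N = M].
Proof.
move=> fF Fb; pose FU A : set L := (F `|` A)%classic.
pose ok A := filter (FU A) /\ ~ FU A b.
have [|A [[fA Ab] Amax]] := @Zorn_bigcup L ok.
  move=> C Cok Ctot; split; last first.
    by case=> // -[A CA Ab]; have [_] := Cok _ CA; apply; right.
  (* Two elements of the union lie in one member of the chain; for elements
     of [F] this needs no member at all, so the empty chain is covered. *)
  have mono a : FU (\bigcup_(X in C) X) a ->
      F a \/ exists2 X, C X & FU X a.
    by case=> [|[X CX Xa]]; [left|right; exists X => //; right].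
  have sub X : C X -> FU X `<=` FU (\bigcup_(X in C) X).
    by move=> CX a [Fa|Xa]; [left|right; exists X].
  split.
  - by left; exact: filter1.
  - move=> x y /mono[Fx|[X CX Xx]] /mono[Fy|[Z CZ Zy]].
    + by left; exact: filterI.
    + apply: (sub Z) => //; apply: filterI => //; [exact: (Cok _ CZ).1|by left].
    + apply: (sub X) => //; apply: filterI => //; [exact: (Cok _ CX).1|by left].
    + have [XZ|ZX] := Ctot _ _ CX CZ.
        apply: (sub Z) => //; apply: filterI => //; first exact: (Cok _ CZ).1.
        by case: Xx => [|/XZ]; [left|right].
      apply: (sub X) => //; apply: filterI => //; first exact: (Cok _ CX).1.
      by case: Zy => [|/ZX]; [left|right].
  - move=> x y xy /mono[Fx|[X CX Xx]]; first by left; exact: filterS Fx.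
    by apply: (sub X) => //; apply: filterS Xx => //; exact: (Cok _ CX).1.
exists (FU A); split => //.
move=> N fN MN Nb; apply/seteqP; split => //.
have FN : FU N = N.
  apply/seteqP; split=> x; last by right.
  by case=> // Fx; apply: MN; left.
apply: contrapT => NM; apply: (Amax N); last by rewrite /ok FN.
split; first by move=> x Ax; apply: MN; right.
by move=> NA; apply: NM => x /NA; right.
Qed.

(** If neither [x] nor [y] belongs to [M], then [b] is above [p & x] and
[q & y] with [p] and [q] in [M], hence above [p & q & (x v y)]. *)
Lemma maximal_avoiding_prime M b : filter M -> ~ M b ->
  (forall N, filter N -> M `<=` N -> ~ N b -> N = M) -> XX L M.
Proof.
move=> fM Mb Mmax; have [M1 MI MS] := fM.
split => //; first by move=> M0; apply: Mb; apply: MS M0; exact: le0x.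
move=> x y Mxy; apply: contrapT => nMxy.
have below z : ~ M z -> exists2 q, M q & q `&` z <= b.
  move=> Mz; have [//|bz] := pselect (adjoin M z b); exfalso; apply: Mz.
  rewrite -(Mmax _ (adjoin_filter z fM) (@sub_adjoin M z) bz).
  exact: adjoin_mem.
have [p Mp px] : exists2 q, M q & q `&` x <= b.
  by apply: below => Mx; apply: nMxy; left.
have [q Mq qy] : exists2 q, M q & q `&` y <= b.
  by apply: below => My; apply: nMxy; right.
apply: Mb; apply: MS (MI _ _ (MI _ _ Mp Mq) Mxy).
rewrite meetUr leUx; apply/andP; split.
  by apply: le_trans px; rewrite leI2// leIl.
by apply: le_trans qy; rewrite leI2// leIr.
Qed.

Lemma prime_filter_separation a b : ~~ (a <= b) ->
  exists P, [/\ XX L P, P a & ~ P b].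
Proof.
move=> ab; pose F := [set x | a <= x].
have fF : filter F.
  split; rewrite /F /=; first exact: lex1.
    by move=> x y ax ay; rewrite lexI ax.
  by move=> x y xy ax; exact: le_trans xy.
have [|M [fM FM Mb Mmax]] := maximal_avoiding_filter (b := b) fF.
  exact/negP.
exists M; split => //; first exact: maximal_avoiding_prime Mmax.
exact: FM (lexx a).
Qed.

Lemma maximal_prime_extension F : filter F -> ~ F \bot ->
  exists2 M, MaxX L M & F `<=` M.
Proof.
move=> fF F0; have [M [fM FM M0 Mmax]] := maximal_avoiding_filter fF F0.
exists M => //; split; first exact: maximal_avoiding_prime Mmax.
move=> Q XQ MQ; apply: Mmax => //; first exact: prime_filter_filter.
by case: XQ.
Qed.

Lemma meet_pcompl a : a `&` pcompl a = \bot.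
Proof. exact/pcomplP. Qed.

Lemma prime_meet P a b : XX L P -> P (a `&` b) <-> P a /\ P b.
Proof.
case=> _ _ PI PS _; split=> [Pab|[]]; last exact: PI.
by split; apply: PS Pab; [exact: leIl|exact: leIr].
Qed.

Lemma prime_join P a b : XX L P -> P (a `|` b) <-> P a \/ P b.
Proof.
case=> _ _ PI PS PU; split=> [/PU //|[]]; apply: PS; [exact: leUl|exact: leUr].
Qed.

(** If [pcompl a] is not in [P], no [q] in [P] is disjoint from [a], so that
[P] and [a] generate a proper filter. *)
Lemma prime_filter_pcompl P a : XX L P ->
  P (pcompl a) <-> forall M, MaxX L M -> P `<=` M -> ~ M a.
Proof.
move=> XP; split=> [Pa M [XM _] PM Ma|noM].
  case: (XM) => _ M0 MI _ _; apply: M0; rewrite -(meet_pcompl a).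
  by apply: MI => //; exact: PM.
apply: contrapT => Pa.
have fP := prime_filter_filter XP.
have [|M MM PM] := maximal_prime_extension (adjoin_filter a fP).
  case=> q Pq; rewrite lex0 => /eqP qa; apply: Pa; apply: (filterS fP) Pq.
  by apply/pcomplP; rewrite meetC.
apply: (noM M) => //; first by apply: subset_trans PM; exact: sub_adjoin.
exact/PM/adjoin_mem.
Qed.

Lemma phi_neg P a : P (neg a) <-> ~ phi P a.
Proof.
split=> [Pa /phiE //|nPa]; apply: contrapT => Pa; apply: nPa; exact/phiE.
Qed.

Lemma phi_sub P Q : phi P `<=` Q -> phi Q `<=` P.
Proof. by move/phi_subset; rewrite phiK. Qed.

Lemma sub_phi P Q : P `<=` phi Q -> Q `<=` phi P.
Proof. by move/phi_subset; rewrite phiK. Qed.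

Lemma phi_MaxX P : MaxX L P -> MinX L (phi P).
Proof.
move=> [XP Pmax]; split; first exact: phi_prime_filter.
move=> Q XQ /sub_phi PQ; rewrite -(Pmax (phi Q)) ?phiK//.
exact: phi_prime_filter.
Qed.

Lemma phi_MinX P : MinX L P -> MaxX L (phi P).
Proof.
move=> [XP Pmin]; split; first exact: phi_prime_filter.
move=> Q XQ /phi_sub PQ; rewrite -(Pmin (phi Q)) ?phiK//.
exact: phi_prime_filter.
Qed.

Lemma phi_Body P : Body L P -> Body L (phi P).
Proof.
move=> [XP nP]; split; first exact: phi_prime_filter.
by case=> [/phi_MaxX|/phi_MinX]; rewrite phiK => ?; apply: nP; [right|left].
Qed.

(** * Closed sets of prime filters *)

(** The prime filters that contain [x] and not [y] are a basic open set of the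
patch topology; hence [separated Q S] says that [Q] is not in the closure
of [S]. *)
Definition separated Q S :=
  exists x y, [/\ Q x, ~ Q y & forall R, S R -> R x -> R y].

Lemma separatedU Q S T : XX L Q -> (S `|` T)%classic `<=` XX L ->
  separated Q S -> separated Q T -> separated Q (S `|` T)%classic.
Proof.
move=> XQ STX [x [y [Qx Qy Sxy]]] [z [t [Qz Qt Tzt]]].
exists (x `&` z), (y `|` t); split.
- exact/prime_meet.
- by move/(prime_join _ _ XQ) => -[].
- move=> R STR; have XR := STX _ STR.
  move/(prime_meet _ _ XR) => [Rx Rz]; apply/(prime_join _ _ XR).
  by case: STR => [/Sxy/(_ Rx)|/Tzt/(_ Rz)]; [left|right].
Qed.

Lemma separated1 Q P : XX L Q -> XX L P -> Q <> P -> separated Q [set P].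
Proof.
move=> XQ XP QP; apply: contrapT => nsep; apply: QP.
apply/seteqP; split=> a ?; apply: contrapT => ?; apply: nsep.
  by exists a, \bot; split; [|case: XQ|move=> R ->].
by exists \top, a; split; [case: XQ| |move=> R ->].
Qed.

Lemma separated_phi Q S T : (forall R, T R -> S (phi R)) ->
  separated (phi Q) S -> separated Q T.
Proof.
move=> TS [x [y [/phiE Qx Qy Sxy]]]; exists (neg y), (neg x); split => //.
  by apply: contrapT => nQy; apply: Qy; apply/phiE.
move=> R /TS SR Ry; apply: contrapT => nRx.
by have /phiE := Sxy _ SR ((phiE R x).2 nRx); apply.
Qed.

(** When [Q] is properly contained in [R], an element [c] of [R] outside [Q]
gives the dense element [c v pcompl c]: it lies in every maximal filter, but
not in [Q], for [pcompl c] would then meet [c] inside [R]. *)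
Lemma separated_MaxX Q : XX L Q -> ~ MaxX L Q -> separated Q (MaxX L).
Proof.
move=> XQ nQ; apply: contrapT => nsep; apply: nQ; split => // R XR QR.
apply/seteqP; split => // c Rc; apply: contrapT => Qc; apply: nsep.
exists \top, (c `|` pcompl c); split; first by case: XQ.
  move/(prime_join _ _ XQ) => [//|/QR Rc'].
  by case: XR => _ R0 RI _ _; apply: R0; rewrite -(meet_pcompl c); exact: RI.
move=> M [XM Mmax] _; apply/(prime_join _ _ XM).
have [Mc|Mc] := pselect (M c); [by left|right].
apply/(prime_filter_pcompl _ XM) => N [XN _] MN.
by rewrite (Mmax N XN MN).
Qed.

Lemma separated_MinX Q : XX L Q -> ~ MinX L Q -> separated Q (MinX L).
Proof.
move=> XQ nQ; apply: (separated_phi (S := MaxX L)); first exact: phi_MinX.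
apply: separated_MaxX; first exact: phi_prime_filter.
by move/phi_MaxX; rewrite phiK.
Qed.

End PrimeFilters.

(** * The quotient by a set of prime filters *)

(** Bundling the points with their stability properties lets the algebra
structure of the quotient be inferred from its type. *)
Record dual_subspace (d : Order.disp_t) (L : pmAlgebraType d) := DualSubspace {
  points : set (set L);
  points_prime : points `<=` XX L;
  points_phi : forall P, points P -> points (phi P);
  points_max : MaxX L `<=` points;
}.

Section Quotient.
Variables (d : Order.disp_t) (L : pmAlgebraType d) (Y : dual_subspace L).

Definition agree (x y : L) : bool := `[< forall P, points Y P -> P x <-> P y >].

Lemma agreeP x y : reflect (forall P, points Y P -> P x <-> P y) (agree x y).
Proof. exact: asboolP. Qed.

Lemma agree_refl : reflexive agree.
Proof. by move=> x; apply/agreeP. Qed.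

Lemma agree_sym : symmetric agree.
Proof.
by move=> x y; apply/agreeP/agreeP => xy P YP; apply: iff_sym; exact: xy.
Qed.

Lemma agree_trans : transitive agree.
Proof.
move=> y x z /agreeP xy /agreeP yz; apply/agreeP => P YP.
exact: iff_trans (xy _ YP) (yz _ YP).
Qed.

Canonical agree_equiv := EquivRel agree agree_refl agree_sym agree_trans.

Definition quotient := {eq_quot agree_equiv}%qT.

HB.instance Definition _ := Choice.on quotient.

Implicit Types (x y : L) (u v w : quotient).

Definition proj x : quotient := (\pi_quotient x)%qT.

Definition holds (P : set L) u : Prop := P (repr u).

Lemma projP x y : proj x = proj y <-> forall P, points Y P -> P x <-> P y.
Proof.
split=> [xy|xy]; first by apply/agreeP; exact/(@eqmodP _ agree_equiv).
by apply/(@eqmodP _ agree_equiv); apply/agreeP.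
Qed.

Lemma proj_repr u : proj (repr u) = u.
Proof. exact: reprK. Qed.

Lemma holds_proj P x : points Y P -> holds P (proj x) <-> P x.
Proof. by apply: (projP _ _).1; rewrite proj_repr. Qed.

Lemma quotient_ext u v :
  (forall P, points Y P -> holds P u <-> holds P v) -> u = v.
Proof. by move/projP; rewrite !proj_repr. Qed.

Definition qle u v : bool := `[< forall P, points Y P -> holds P u -> holds P v >].

Lemma qleP u v : reflect (forall P, points Y P -> holds P u -> holds P v) (qle u v).
Proof. exact: asboolP. Qed.

Lemma qle_refl : reflexive qle.
Proof. by move=> u; apply/qleP. Qed.

Lemma qle_anti : antisymmetric qle.
Proof.
move=> u v /andP[/qleP uv /qleP vu]; apply: quotient_ext => P YP.
by split; [exact: uv|exact: vu].
Qed.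

Lemma qle_trans : transitive qle.
Proof.
by move=> v u w /qleP uv /qleP vw; apply/qleP => P YP /(uv _ YP)/(vw _ YP).
Qed.

Fact quotient_display : Order.disp_t. Proof. exact: Order.Disp tt tt. Qed.

HB.instance Definition _ :=
  Order.Le_isPOrder.Build quotient_display quotient qle_refl qle_anti qle_trans.

Definition qmeet u v := proj (repr u `&` repr v).
Definition qjoin u v := proj (repr u `|` repr v).
Definition qneg u := proj (neg (repr u)).
Definition qpcompl u := proj (pcompl (repr u)).

Lemma holds_meet P u v : points Y P -> holds P (qmeet u v) <-> holds P u /\ holds P v.
Proof.
move=> YP; apply: iff_trans (holds_proj _ YP) _.
exact/prime_meet/(points_prime YP).
Qed.

Lemma holds_join P u v : points Y P -> holds P (qjoin u v) <-> holds P u \/ holds P v.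
Proof.
move=> YP; apply: iff_trans (holds_proj _ YP) _.
exact/prime_join/(points_prime YP).
Qed.

Lemma holds_neg P u : points Y P -> holds P (qneg u) <-> ~ holds (phi P) u.
Proof.
move=> YP; apply: iff_trans (holds_proj _ YP) _.
exact: phi_neg.
Qed.

Lemma holds_pcompl P u : points Y P -> holds P (qpcompl u) <->
  forall M, MaxX L M -> P `<=` M -> ~ holds M u.
Proof.
move=> YP; apply: iff_trans (holds_proj _ YP) _.
exact/prime_filter_pcompl/(points_prime YP).
Qed.

Lemma qmeetP u v w : (u <= qmeet v w) = (u <= v) && (u <= w).
Proof.
apply/qleP/andP => [uvw|[/qleP uv /qleP uw] P YP Pu].
  by split; apply/qleP => P YP /(uvw _ YP)/(holds_meet _ _ YP) [].
by apply/(holds_meet _ _ YP); split; [exact: uv|exact: uw].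
Qed.

Lemma qjoinP u v w : (qjoin u v <= w) = (u <= w) && (v <= w).
Proof.
apply/qleP/andP => [uvw|[/qleP uw /qleP vw] P YP].
  by split; apply/qleP => P YP Pu; apply: uvw => //; apply/(holds_join _ _ YP);
    [left|right].
by case/(holds_join _ _ YP); [exact: uw|exact: vw].
Qed.

HB.instance Definition _ := Order.POrder_MeetJoin_isLattice.Build
  quotient_display quotient qmeetP qjoinP.

Lemma qmeetUl : left_distributive qmeet qjoin.
Proof.
move=> u v w; apply: quotient_ext => P YP.
have mt := holds_meet _ _ YP; have jn := holds_join _ _ YP.
split.
  move=> /mt[/jn[Pu|Pv] Pw]; apply/jn; [left|right]; exact/mt.
by move=> /jn[] /mt[Pu Pw]; apply/mt; split => //; apply/jn; [left|right].
Qed.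

HB.instance Definition _ := Order.Lattice_Meet_isDistrLattice.Build
  quotient_display quotient qmeetUl.

Lemma qle0x u : proj \bot <= u.
Proof.
apply/qleP => P YP /(holds_proj _ YP) P0.
by case: (points_prime YP) => _ /(_ P0).
Qed.

Lemma qlex1 u : u <= proj \top.
Proof.
by apply/qleP => P YP _; apply/(holds_proj _ YP); case: (points_prime YP).
Qed.

HB.instance Definition _ :=
  Order.hasBottom.Build quotient_display quotient qle0x.
HB.instance Definition _ :=
  Order.hasTop.Build quotient_display quotient qlex1.

Lemma qnegK u : qneg (qneg u) = u.
Proof.
apply: quotient_ext => P YP; apply: iff_trans (holds_neg _ YP) _.
have YfP := points_phi YP; split=> [nPu|Pu /(holds_neg _ YfP)].
  by apply: contrapT => Pu; apply/nPu/(holds_neg _ YfP); rewrite phiK.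
by rewrite phiK => /(_ Pu).
Qed.

Lemma qnegI u v : qneg (u `&` v) = qneg u `|` qneg v.
Proof.
apply: quotient_ext => P YP; have YfP := points_phi YP.
apply: iff_trans (holds_neg _ YP) _.
apply: iff_trans (iff_sym (holds_join _ _ YP)).
have ng w := holds_neg w YP; split=> [nPuv|].
  have [Pu|Pu] := pselect (holds (phi P) u); last by left; apply/ng.
  by right; apply/ng => Pv; apply: nPuv; apply/(holds_meet _ _ YfP).
by move=> h /(holds_meet _ _ YfP) [Pu Pv]; case: h => /ng; apply.
Qed.

Lemma qpcomplP u v : u `&` v = \bot <-> v <= qpcompl u.
Proof.
split=> [uv0|/qleP vu].
  apply/qleP => P YP Pv; apply/(holds_pcompl _ YP) => M MM PM Mu.
  have YM := points_max Y MM.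
  have : holds M (\bot : quotient).
    by rewrite -uv0; apply/(holds_meet _ _ YM); split => //; exact: PM.
  by move/(holds_proj _ YM) => M0; case: (points_prime YM) => _ /(_ M0).
apply/eqP; rewrite -lex0; apply/qleP => P YP /(holds_meet _ _ YP) [Pu Pv].
exfalso; have XP := points_prime YP.
have [|M MM PM] := maximal_prime_extension (prime_filter_filter XP).
  by case: XP.
by have /(holds_pcompl _ YP)/(_ M MM PM) := vu _ YP Pv; apply; exact: PM.
Qed.

HB.instance Definition _ := isPseudocomplementedDeMorgan.Build
  quotient_display quotient qnegK qnegI qpcomplP.

Lemma proj_morphism : pm_morphism proj.
Proof.
split => //.
- move=> x y; apply: quotient_ext => P YP; have XP := points_prime YP.
  have hp z := holds_proj z YP.
  apply: iff_trans (hp _) _; apply: iff_trans (iff_sym (holds_meet _ _ YP)).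
  apply: iff_trans (prime_meet _ _ XP) _.
  by split=> -[/hp ? /hp ?].
- move=> x y; apply: quotient_ext => P YP; have XP := points_prime YP.
  have hp z := holds_proj z YP.
  apply: iff_trans (hp _) _; apply: iff_trans (iff_sym (holds_join _ _ YP)).
  apply: iff_trans (prime_join _ _ XP) _.
  by split=> -[/hp ?|/hp ?]; [left|right|left|right].
- move=> x; apply: quotient_ext => P YP.
  have hp z := holds_proj z (points_phi YP).
  apply: iff_trans (holds_proj _ YP) _.
  apply: iff_trans (iff_sym (holds_neg _ YP)).
  apply: iff_trans (phi_neg _ _) _.
  by split=> nP /hp.
- move=> x; apply: quotient_ext => P YP; have XP := points_prime YP.
  apply: iff_trans (holds_proj _ YP) _.
  apply: iff_trans (iff_sym (holds_pcompl _ YP)).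
  apply: iff_trans (prime_filter_pcompl _ XP) _.
  by split=> noM M MM PM /(holds_proj _ (points_max Y MM)); exact: noM.
Qed.

End Quotient.

(** * Subdirect irreducibility *)

Section BodyOrbits.
Variables (d : Order.disp_t) (L : pmAlgebraType d).

Definition orbit_points (P : set L) : set (set L) :=
  (MaxX L `|` MinX L `|` [set P; phi P])%classic.

Lemma orbit_points_prime P : XX L P -> orbit_points P `<=` XX L.
Proof.
move=> XP Q [[[]|[]]|[->|->]] //; exact: phi_prime_filter.
Qed.

Lemma orbit_points_phi P Q : orbit_points P Q -> orbit_points P (phi Q).
Proof.
case=> [[/phi_MaxX|/phi_MinX]|[->|->]].
- by left; right.
- by left; left.
- by right; right.
- by rewrite phiK; right; left.
Qed.

Lemma MaxX_orbit_points P : MaxX L `<=` orbit_points P.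
Proof. by move=> Q; left; left. Qed.

Definition orbit_subspace P (XP : XX L P) : dual_subspace L :=
  DualSubspace (orbit_points_prime XP) (@orbit_points_phi P)
    (@MaxX_orbit_points P).

(** With [x] in [Q] and [y] not in [Q] such that each member of [Y] containing
[x] contains [y], the elements [x] and [x & y] are distinct but congruent. *)
Lemma separated_not_injective (Y : dual_subspace L) Q :
  XX L Q -> separated Q (points Y) -> ~ injective (proj Y).
Proof.
move=> XQ [x [y [Qx Qy Yxy]]] inj.
have : x = x `&` y.
  apply: inj; apply/projP => P YP; split; last first.
    by move/(prime_meet _ _ (points_prime YP)) => [].
  by move=> Px; apply/(prime_meet _ _ (points_prime YP)); split; last exact: Yxy.
by move=> xy; move: Qx; rewrite xy => /(prime_meet _ _ XQ) [].
Qed.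

Lemma Body_orbit_of_injective P (XP : XX L P) :
  injective (proj (orbit_subspace XP)) -> Body L `<=` [set P; phi P].
Proof.
move=> inj Q [XQ nQ]; apply: contrapT => nQP.
apply: (separated_not_injective (Y := orbit_subspace XP) XQ) inj.
have sub := orbit_points_prime XP.
have XfP := phi_prime_filter XP.
apply: separatedU => //.
- apply: separatedU => //; first by move=> R RM; apply: sub; left.
  + by apply: separated_MaxX => // QM; apply: nQ; left.
  + by apply: separated_MinX => // Qm; apply: nQ; right.
- apply: separatedU => //; first by move=> R RP; apply: sub; right.
  + by apply: separated1 => // QP; apply: nQP; left.
  + by apply: separated1 => // QP; apply: nQP; right.
Qed.

(** Two distinct elements are separated by some prime filter, which is either
in the body or a point of all the subspaces. *)
Lemma orbit_quotients_subdirect : Body L !=set0 ->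
  subdirect_embedding (fun i : {P | Body L P} =>
    proj (orbit_subspace (proj1 (proj2_sig i)))).
Proof.
move=> [P0 BP0]; split.
- move=> i; exact: proj_morphism.
- move=> x y xy.
  have le_of (a b : L) : (forall P, XX L P -> P a -> P b) -> a <= b.
    move=> ab; apply: contrapT => /negP /prime_filter_separation [P [XP Pa]].
    by apply; exact: ab Pa.
  have same P : XX L P -> P x <-> P y.
    move=> XP; have [BP|nBP] := pselect (Body L P).
      by apply: (projP _ _ _).1 (xy (exist _ P BP)) _ _; right; left.
    apply: (projP _ _ _).1 (xy (exist _ P0 BP0)) _ _; left.
    by apply: contrapT => nP; apply: nBP.
  by apply/eqP; rewrite eq_le !le_of // => P XP; case: (same P XP).
- by move=> i b; exists (repr b); exact: proj_repr.
Qed.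

End BodyOrbits.

Theorem corollary2p7 (d : Order.disp_t) (L : pmAlgebraType d) :
  subdirectly_irreducible L ->
  (exists2 n : nat, (n < 2)%N & Body L #= `I_n) \/
  (exists2 P : set L, phi P <> P & Body L = [set P; phi P]).
Proof.
move=> SI; have [B0|/set0P Bn0] := eqVneq (Body L) set0.
  by left; exists 0%N => //; rewrite B0 II0.
have [P0 BP0] := Bn0.
have [[P BP] [_ /bij_inj inj]] := SI _ _ _ _
  (inhabits (exist _ P0 BP0 : {P | Body L P})) (orbit_quotients_subdirect Bn0).
have BE : Body L = [set P; phi P].
  apply/seteqP; split; first exact: Body_orbit_of_injective inj.
  by move=> Q [->|->] //; exact: phi_Body.
have [fP|fP] := pselect (phi P = P); last by right; exists P.
by left; exists 1%N => //; rewrite BE fP setUid; exact: card_set1.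
Qed.
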